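(* Let $U$ be a unitary operator in a Hilbert space $\mathcal{H}$, and let $\mathcal{L}\subset\mathcal{H}$ be a closed subspace. (1) If $\mathcal{L}\in\mathbf{Sd}^U$, then $\mathcal{L}^\perp\in\mathbf{Sd}^U$. (2) If $\mathcal{L}$ is an invariant subspace for $U$ (i.e. $U\mathcal{L}\subset\mathcal{L}$), then $\mathcal{L}\in\mathbf{Sd}^U$. (3) As a consequence of (1) and (2), if $\mathcal{L}$ is invariant for $U^*$, then $\mathcal{L}\in\mathbf{Sd}^U$.
   Context: An operator $T$ acting in a Hilbert space is called Schmidt decomposable if it has a singular value decomposition: there exist orthonormal systems $\{f_n:n\ge1\}$ and $\{g_n:n\ge1\}$ and positive numbers $s_n$ such that $T=\sum_{n\ge1}s_n\,f_n\otimes g_n$, where $(f\otimes g)(h)=\langle h,g\rangle f$. For a unitary operator $U$ in $\mathcal{H}$, $\mathbf{Sd}^U$ is the set of closed subspaces $\mathcal{L}\subset\mathcal{H}$ such that $P_{\mathcal{L}}U|_{\mathcal{L}}:\mathcal{L}\to\mathcal{L}$ is Schmidt decomposable, where $P_{\mathcal{L}}$ is the orthogonal projection onto $\mathcal{L}$.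
   Formalization: The orthonormal systems in the singular value decomposition may have any index set, not only n≥1, since on a nonseparable space (2) fails for U=1, L=H with countable sums; in a separable space the systems are countable, as in the English. *)

(* Defs.v *)
From HB Require Import structures.
From mathcomp Require Import all_boot all_order all_algebra.
From mathcomp Require Import complex.
From mathcomp Require Import all_classical all_reals all_analysis.
From mathcomp Require Import summability.

Set Implicit Arguments.
Unset Strict Implicit.
Unset Printing Implicit Defensive.

Import Order.TTheory GRing.Theory Num.Theory.
Import numFieldNormedType.Exports.
Local Open Scope classical_set_scope.
Local Open Scope ring_scope.
Local Open Scope complex_scope.

(* Complex Hilbert spaces, with an inner product that is linear in its first
   argument and conjugate-linear in its second one. *)
HB.mixin Record CompleteNormedModule_isHilbert (R : realType) H
    of CompleteNormedModule R[i] H := {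
  inner : {dot H for Num.conj} ;
  sqr_norm_inner : forall x : H, `|x| ^+ 2 = inner x x
}.

#[short(type="hilbertType")]
HB.structure Definition Hilbert (R : realType) :=
  {H of CompleteNormedModule R[i] H & CompleteNormedModule_isHilbert R H}.

Section SchmidtDecomposability.
Variables (R : realType) (H : hilbertType R).
Local Notation "''[' x , y ]" := (inner x y) : ring_scope.

Implicit Types (L : set H) (T U V : H -> H).

Definition closed_subspace L := submod_closed (mem L) /\ closed L.

Definition ortho_compl L : set H :=
  [set y | forall x, L x -> '[y, x] = 0].

(* P_L x is the point of L such that x - P_L x is orthogonal to L; it exists
   and is unique when L is a closed subspace. *)
Definition orthoproj L (x : H) : H :=
  xget 0 [set y | L y /\ ortho_compl L (x - y)].

Definition is_adjoint U V := forall x y, '[U x, y] = '[x, V y].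

Definition unitary U := exists V, [/\ is_adjoint U V, cancel U V & cancel V U].

Definition invariant_subspace U L := U @` L `<=` L.

Definition orthonormal_system (J : Type) (f : J -> H) :=
  (forall j, '[f j, f j] = 1) /\
  (forall j k, j <> k -> '[f j, f k] = 0).

Definition rank_one (f g h : H) : H := '[h, g] *: f.

(* T = \sum_j s_j f_j (x) g_j as an operator of the Hilbert space L, the sum
   being the pointwise limit of its finite partial sums (for orthogonal terms
   this does not depend on the order of summation). *)
Definition singular_value_decomposition L T
    (J : choiceType) (s : J -> R) (f g : J -> H) :=
  [/\ orthonormal_system f /\ (forall j, L (f j)),
      orthonormal_system g /\ (forall j, L (g j)),
      (forall j, 0 < s j) &
      forall h, L h ->
        partial_sum (fun j => (s j)%:C *: rank_one (f j) (g j) h) A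
          @[A --> totally] --> T h].

(* The index set J may be finite, empty or infinite; it is countable as soon as
   H is separable, see countable_orthonormal_system. Uncountable ones are
   needed on nonseparable spaces, where a countable sum cannot even represent
   the identity. *)
Definition schmidt_decomposable_on L T :=
  exists (J : choiceType) (s : J -> R) (f g : J -> H),
    singular_value_decomposition L T s f g.

Definition Sd U : set (set H) :=
  [set L | closed_subspace L /\ schmidt_decomposable_on L (orthoproj L \o U)].

Lemma countable_orthonormal_system (D : set H) (J : choiceType) (f : J -> H) :
  countable D -> dense D -> orthonormal_system f -> countable [set: J].
Proof.
move=> Dcount Ddense [f1 f0].
have near_f j : exists d, D d /\ `|f j - d| < 2^-1.
  have [||d [fd Dd]] := Ddense (ball (f j) (2^-1 : R[i])).
  - by exists (f j); apply: ballxx; rewrite invr_gt0.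
  - exact: ball_open.
  by exists d; split=> //; rewrite -ball_normE in fd.
have [d dP] := choice near_f.
have d_inj : injective d.
  move=> j k djk; apply: contrapT => /[dup] njk /f0 fjk.
  have fkj : '[f k, f j] = 0 by apply: f0; apply: nesym.
  have : `|f j - f k| ^+ 2 < 1.
    rewrite expr_lt1 ?normr_ge0// -(subrKA (d j)).
    apply: (le_lt_trans (ler_normD _ _)); rewrite [ltRHS]splitr.
    by rewrite div1r ltrD ?(dP j).2// distrC djk (dP k).2.
  rewrite sqr_norm_inner linearB/= !linearBl/= !f1 fjk fkj.
  by rewrite subr0 sub0r opprK gtrDl ltr10.
rewrite -(eq_countable (inj_card_eq (in2W d_inj))).
apply: sub_countable Dcount; apply: subset_card_le.
by move=> _ [j _ <-]; exact: (dP j).1.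
Qed.

End SchmidtDecomposability.

(* Main.v *)
Require Import Defs.
From HB Require Import structures.
From mathcomp Require Import all_boot all_order all_algebra.
From mathcomp Require Import all_classical all_reals all_analysis.
From mathcomp Require Import complex finmap summability.

Set Implicit Arguments.
Unset Strict Implicit.
Unset Printing Implicit Defensive.

Import Order.TTheory GRing.Theory Num.Theory.
Import numFieldNormedType.Exports.
Local Open Scope classical_set_scope.

(**
Write [M] for the orthogonal complement of [L], [P] and [Q] for the orthogonal
projections onto [L] and [M], and [V] for the inverse, hence adjoint, of [U].

A compression [T] of [U] to [L] is Schmidt decomposable as soon as [L] contains
an orthogonal family [w] which [T] maps to an orthogonal family and such that
[T] kills the vectors of [L] orthogonal to every [w j] with nonzero image:
normalizing these [w j] and [T (w j)] gives the two orthonormal systems, the singular values are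
the ratios of the norms, and the series converges because the Fourier series
of a vector along any orthonormal system does. This is
[compression_schmidt].

If [L] is invariant, the compression is the isometry [U] itself, and any
complete orthonormal system of [L] will do ([Sd_invariant]). If [L] is invariant
under [V], then [M] is invariant under [U] and therefore belongs to [Sd U], and
so does [L], the orthogonal complement of [M] ([ortho_complK]).

The substance is [Sd_ortho_compl]. In the block form of [U] along [L] and [M],
unitarity makes the diagonal blocks [T = P U] on [L] and [S = Q U] on [M] share
their singular values smaller than [1]. Concretely, let [T] be the sum of the
[s_j f_j (x) g_j]. Then [V f_j - s_j g_j] and [U g_j - s_j f_j] both lie in [M],
and
[[
  S (V f_j - s_j g_j) = - s_j (U g_j - s_j f_j),
]]
which provides orthogonal vectors with orthogonal images. To them one adds a
complete orthonormal system of the space [N] of those [x] in [M] such that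
[U x] is also in [M], on which [S] is isometric. Any [x] in [M] orthogonal to
all these vectors satisfies [S x = 0]: with [y = P U x], orthogonality to
[V f_j - s_j g_j] says that [y] is orthogonal to [f_j], hence to the range of
[T], so that [V y] is in [M]; then [z = x - V y] is in [N] because
[U z = U x - y = S x]. As [x] and [V y] are both orthogonal to the chosen system
of [N], so is [z], whence [z = 0] and [S x = U z = 0].
*)

#[local] Existing Instance totally_filter.

Section HilbertSpace.
Local Open Scope ring_scope.
Local Open Scope complex_scope.
Variables (R : realType) (H : hilbertType R).
Local Notation "''[' x , y ]" := (inner x y) : ring_scope.
Implicit Types (x y z : H) (L : set H).

(** * Inner product *)

Lemma innerC x y : '[x, y] = Num.conj '[y, x].
Proof. by rewrite hermC expr0 mul1r. Qed.

Lemma inner_sym0 x y : '[x, y] = 0 -> '[y, x] = 0.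
Proof. by rewrite innerC => /eqP; rewrite conjC_eq0 => /eqP. Qed.

Lemma innerDl x y z : '[x + y, z] = '[x, z] + '[y, z].
Proof. exact: linearDl. Qed.

Lemma innerBl x y z : '[x - y, z] = '[x, z] - '[y, z].
Proof. exact: linearBl. Qed.

Lemma innerZl (a : R[i]) x z : '[a *: x, z] = a * '[x, z].
Proof. exact: linearZl_LR. Qed.

Lemma inner_suml (I : Type) (r : seq I) (E : I -> H) z :
  '[\sum_(i <- r) E i, z] = \sum_(i <- r) '[E i, z].
Proof. exact: linear_sumlz. Qed.

Lemma innerDr x y z : '[x, y + z] = '[x, y] + '[x, z].
Proof. exact: linearDr. Qed.

Lemma innerBr x y z : '[x, y - z] = '[x, y] - '[x, z].
Proof. exact: linearBr. Qed.

Lemma innerZr (a : R[i]) x z : '[x, a *: z] = Num.conj a * '[x, z].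
Proof. exact: linearZr_LR. Qed.

Lemma inner0l x : '[0, x] = 0.
Proof. by rewrite -(subrr 0) innerBl subrr. Qed.

Lemma inner_eq0 x : '[x, x] = 0 -> x = 0.
Proof.
by rewrite -sqr_norm_inner => /eqP; rewrite expf_eq0/= normr_eq0 => /eqP.
Qed.

Lemma unit_neq0 x : '[x, x] = 1 -> x != 0.
Proof. by apply: contra_eq_neq => ->; rewrite inner0l eq_sym oner_eq0. Qed.

Lemma pythagoras x y : '[x, y] = 0 -> `|x + y| ^+ 2 = `|x| ^+ 2 + `|y| ^+ 2.
Proof.
move=> xy0; rewrite !sqr_norm_inner innerDl !innerDr xy0 (inner_sym0 xy0).
by rewrite addr0 add0r.
Qed.

Lemma cauchy_schwarz x y : `|'[x, y]| <= `|x| * `|y|.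
Proof.
have [->|y0] := eqVneq y 0.
  by rewrite (inner_sym0 (inner0l x)) !normr0 mulr0.
pose p := ('[x, y] / `|y| ^+ 2) *: y.
have pE : '[p, y] = '[x, y].
  by rewrite innerZl -sqr_norm_inner divfK// expf_neq0// normr_eq0.
have /pythagoras : '[x - p, p] = 0.
  by rewrite innerZr innerBl pE subrr mulr0.
rewrite subrK => xE.
have : `|p| <= `|x|.
  by rewrite -(@ler_pXn2r _ 2)// ?nnegrE// xE lerDr exprn_ge0.
rewrite normrZ normrM normfV (ger0_norm (exprn_ge0 2 (normr_ge0 y))).
rewrite expr2 invfM mulrA mulfVK ?normr_eq0//.
by rewrite ler_pdivrMr// normr_gt0.
Qed.

(** Stated with an arbitrary approximation so as to give both the closedness of
  orthogonal complements and the passage to the limit in [inner_cvg]. *)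
Lemma inner_approx x z (c : R[i]) :
  (forall e : R[i], 0 < e -> exists y, `|x - y| <= e /\ '[y, z] = c) ->
  '[x, z] = c.
Proof.
move=> xy; apply/eqP; rewrite -subr_eq0 -normr_le0; apply/ler_addgt0Pr => e e0.
have z1 : 0 < `|z| + 1 by rewrite ltr_wpDl.
have [|y [xye <-]] := xy (e / (`|z| + 1)); first by rewrite divr_gt0.
rewrite add0r -innerBl (le_trans (cauchy_schwarz _ _))//.
rewrite (@le_trans _ _ (e / (`|z| + 1) * (`|z| + 1)))//.
  by rewrite ler_pM// lerDl.
by rewrite divfK// gt_eqF.
Qed.

Lemma inner_cvg (T : Type) (F : set_system T) {FF : ProperFilter F}
    (h : T -> H) x z (c : R[i]) :
  h @ F --> x -> (\forall t \near F, '[h t, z] = c) -> '[x, z] = c.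
Proof.
move=> hx hc; apply: inner_approx => e e0.
have hxe : \forall t \near F, `|x - h t| <= e.
  exact: (pseudometric_normed_Zmodule.cvgr_dist_le _ _ hx).
have [t [? ?]] := filter_ex (filterI hxe hc).
by exists (h t).
Qed.

(** * Closed subspaces *)

Lemma closed_subspaceP L :
  closed_subspace L <->
  [/\ L 0, (forall a x y, L x -> L y -> L (a *: x + y)) & closed L].
Proof.
split=> [[[/set_mem L0 Ll] cL]|[L0 Ll cL]]; split=> //.
- by move=> a x y Lx Ly; apply/set_mem/Ll; apply/mem_set.
- split; first exact/mem_set.
  by move=> a x y /set_mem Lx /set_mem Ly; apply/mem_set/Ll.
Qed.

Section ClosedSubspace.
Variables (L : set H) (sL : closed_subspace L).

Lemma subspace0 : L 0.
Proof. by have /closed_subspaceP[] := sL. Qed.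

Lemma subspaceZD a x y : L x -> L y -> L (a *: x + y).
Proof. by have /closed_subspaceP[_ + _] := sL; apply. Qed.

Lemma subspaceZ a x : L x -> L (a *: x).
Proof. by move=> Lx; rewrite -[_ *: _]addr0; apply/subspaceZD/subspace0. Qed.

Lemma subspaceB x y : L x -> L y -> L (x - y).
Proof. by move=> Lx Ly; rewrite addrC -scaleN1r; apply: subspaceZD. Qed.

Lemma subspace_sum (J : choiceType) (f : J -> H) A :
  (forall j, L (f j)) -> L (partial_sum f A).
Proof.
move=> Lf; rewrite /partial_sum; elim/big_ind: _ => //.
- exact: subspace0.
- by move=> x y Lx Ly; rewrite -[x]scale1r; apply: subspaceZD.
Qed.

Lemma subspace_cvg (T : Type) (F : set_system T) {FF : ProperFilter F}
    (h : T -> H) x : (forall t, L (h t)) -> h @ F --> x -> L x.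
Proof.
by move=> Lh; apply: (closed_cvg L); [exact: sL.2|exact: nearW].
Qed.

End ClosedSubspace.

Lemma ortho_compl_closed_subspace L : closed_subspace (ortho_compl L).
Proof.
apply/closed_subspaceP; split.
- by move=> x _; exact: inner0l.
- by move=> a x y Lx Ly z Lz; rewrite innerDl innerZl Lx// Ly// mulr0 addr0.
- move=> x Mx z Lz; apply: inner_approx => e e0.
  have [y [/= My]] := Mx _ (nbhsx_ballx x _ e0).
  by rewrite -ball_normE => /ltW xye; exists y; split => //; exact: My.
Qed.

(** * Fourier series and orthogonal projections *)

Section FourierSeries.
Variables (J : choiceType) (e : J -> H) (e_on : orthonormal_system e).
Let S x : {fset J} -> H := partial_sum (fun j => '[x, e j] *: e j).

Lemma inner_partial_sum (c : J -> R[i]) (A : {fset J}) k :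
  '[partial_sum (fun j => c j *: e j) A, e k] = if k \in A then c k else 0.
Proof.
rewrite /partial_sum inner_suml; case: ifPn => kA.
  rewrite (bigD1 [` kA]%fset)//= innerZl (e_on.1) mulr1 big1 ?addr0// => j jk.
  rewrite innerZl e_on.2 ?mulr0// => jek; move/eqP: jk; apply.
  exact/val_inj.
rewrite big1// => j _; rewrite innerZl e_on.2 ?mulr0// => jk.
by move: kA; rewrite -jk (valP j).
Qed.

Lemma inner_fourier_sum x y A :
  (forall k, k \in A -> '[y, e k] = 0) -> '[y, S x A] = 0.
Proof.
move=> yA; apply: inner_sym0; rewrite /S/partial_sum inner_suml big1// => j _.
by rewrite innerZl (inner_sym0 (yA _ (valP j))) mulr0.
Qed.

(** Bessel's inequality. *)
Lemma fourier_sum_le x A : `|S x A| ^+ 2 <= `|x| ^+ 2.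
Proof.
rewrite -[X in _ <= `|X| ^+ 2](subrK (S x A)) pythagoras; last first.
  by apply: inner_fourier_sum => k kA; rewrite innerBl inner_partial_sum kA subrr.
by rewrite lerDr exprn_ge0.
Qed.

Lemma fourier_sum_sub x A B : (A `<=` B)%fset ->
  `|S x B - S x A| ^+ 2 = `|S x B| ^+ 2 - `|S x A| ^+ 2.
Proof.
move=> AB; have /pythagoras : '[S x B - S x A, S x A] = 0; last first.
  by rewrite subrK => ->; rewrite addrK.
apply: inner_fourier_sum => k kA.
by rewrite innerBl !inner_partial_sum kA (fsubsetP AB)// subrr.
Qed.

(** By [fourier_sum_sub], two partial sums are close as soon as their norms are;
  these increase with [A] and are bounded by [fourier_sum_le], so that a partial
  sum whose norm is nearly the supremum is close to all larger ones. *)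
Lemma fourier_cvg x : exists y, S x A @[A --> totally] --> y.
Proof.
pose E := [set complex.Re (`|S x A| ^+ 2) | A in setT].
have sq_real y : ((complex.Re (`|y| ^+ 2))%:C = `|y| ^+ 2 :> R[i])%C.
  by rewrite RRe_real// ger0_real// exprn_ge0.
have supE : has_sup E.
  split; first by exists (complex.Re (`|S x fset0| ^+ 2)), fset0.
  exists (complex.Re (`|x| ^+ 2)) => _ [A _ <-].
  by rewrite -lecR !sq_real fourier_sum_le.
suff : cauchy (S x A @[A --> totally]).
  by move=> cS; apply/cvg_ex; exact: cauchy_cvg.
apply: cauchy_exP => r r0.
have rE : ((complex.Re r)%:C = r)%C by rewrite RRe_real// gtr0_real.
have [_ [A _ <-] supA] : exists2 a, E a & sup E - complex.Re r ^+ 2 < a.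
  by apply: sup_adherent => //; rewrite exprn_gt0// -ltcR rE.
exists (S x A); apply: (ex_intro2 _ _ A) => // B AB /=.
rewrite -ball_normE/= distrC -(@ltr_pXn2r _ 2)// ?nnegrE// ?ltW//.
rewrite fourier_sum_sub// -(sq_real (S x A)) -(sq_real (S x B)) -rE.
rewrite -rmorphXn -rmorphB ltcR.
have : complex.Re (`|S x B| ^+ 2) <= sup E.
  by apply: ub_le_sup; [exact: supE.2|exists B].
rewrite ltrBlDr.
by move=> /le_lt_trans; apply; rewrite -ltrBlDl.
Qed.

Lemma fourier_limit L x : closed_subspace L -> (forall j, L (e j)) ->
  exists y, [/\ S x A @[A --> totally] --> y, L y &
    forall k, '[x - y, e k] = 0].
Proof.
move=> sL Le; have [y Sy] := fourier_cvg x; exists y; split=> // [|k].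
- apply: (subspace_cvg sL _ Sy) => A.
  by apply: (subspace_sum sL) => j; exact: subspaceZ.
- rewrite innerBl; suff -> : '[y, e k] = '[x, e k] by rewrite subrr.
  apply: (inner_cvg Sy); exists [fset k]%fset => // A kA.
  by rewrite /= inner_partial_sum (fsubsetP kA)// inE.
Qed.

End FourierSeries.

(** Zorn's lemma among the orthonormal subsets of [L], each of them being its
  own index type: a nonzero vector of [L] orthogonal to a maximal one could be
  normalized and added to it. *)
Lemma orthonormal_basis_exists L : closed_subspace L ->
  exists (J : choiceType) (e : J -> H), [/\ orthonormal_system e,
    forall j, L (e j) & forall x, L x -> (forall j, '[x, e j] = 0) -> x = 0].
Proof.
move=> sL.
pose P (E : set H) := [/\ E `<=` L, forall x, E x -> '[x, x] = 1 &
  forall x y, E x -> E y -> x <> y -> '[x, y] = 0].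
have [|E [[EL E1 E0] Emax]] := @Zorn_bigcup H P.
  move=> F FP totF; split.
  - by move=> x [E /FP[EL _ _] /EL].
  - by move=> x [E /FP[_ E1 _] /E1].
  - move=> x y [A FA Ax] [B FB By].
    case: (totF _ _ FA FB) => [/(_ _ Ax) Bx|/(_ _ By) Ay].
    + by have [_ _ B0] := FP _ FB; exact: B0.
    + by have [_ _ A0] := FP _ FA; exact: A0.
exists (set_type E), (fun j => val j); split.
- split=> [j|j k jk]; first exact/E1/set_valP.
  apply: E0; try exact: set_valP.
  by move=> jke; apply: jk; exact: val_inj.
- by move=> j; exact/EL/set_valP.
move=> x Lx xE; apply: contrapT => x0.
have nx0 : `|x| != 0 by rewrite normr_eq0; apply/eqP.
pose u := `|x|^-1 *: x.
have uE z : E z -> '[u, z] = 0.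
  move=> Ez; rewrite innerZl.
  by have := xE (SigSub (mem_set Ez)) => /= ->; rewrite mulr0.
have uu : '[u, u] = 1.
  by rewrite -sqr_norm_inner normrZ normfV normr_id mulVf// expr1n.
apply: (Emax (E `|` [set u])).
  split=> [|EuE]; first exact: subsetUl.
  have /uE := EuE u (or_intror erefl).
  by rewrite uu => /eqP; rewrite oner_eq0.
split.
- by move=> _ [/EL//|->]; exact: subspaceZ.
- by move=> _ [/E1//|->].
- move=> y z [Ey|->] [Ez|->] yz; [exact: E0|exact/inner_sym0/uE|exact: uE|].
  by case: yz.
Qed.

(** The projection of [x] is the sum of its Fourier series along a complete
  system [e] of [L]. That [x - y] is orthogonal to every [h] in [L], and not only
  to the [e k], holds because [h] is itself the sum of its Fourier series. *)
Lemma projection_exists L x : closed_subspace L ->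
  exists y, L y /\ ortho_compl L (x - y).
Proof.
move=> sL; have [J [e [e_on Le e_total]]] := orthonormal_basis_exists sL.
have [y [Sy Ly xye]] := fourier_limit e_on x sL Le.
exists y; split => // h Lh; apply: inner_sym0.
have [h' [Sh' Lh' hh'e]] := fourier_limit e_on h sL Le.
have <- : h' = h.
  by apply/esym/eqP; rewrite -subr_eq0; apply/eqP/e_total => //; exact: subspaceB.
apply: (inner_cvg Sh'); apply: nearW => A.
by apply: inner_sym0; apply: inner_fourier_sum => k _.
Qed.

Lemma orthoprojP L x : closed_subspace L ->
  L (orthoproj L x) /\ ortho_compl L (x - orthoproj L x).
Proof. by move=> /(projection_exists x); exact: xgetPex. Qed.

Lemma orthoproj_in L x : closed_subspace L -> L (orthoproj L x).
Proof. by move=> /(orthoprojP x)[]. Qed.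

Lemma sub_orthoproj L x :
  closed_subspace L -> ortho_compl L (x - orthoproj L x).
Proof. by move=> /(orthoprojP x)[]. Qed.

Lemma orthoproj_eq L x y : closed_subspace L ->
  L y -> ortho_compl L (x - y) -> orthoproj L x = y.
Proof.
move=> sL Ly xy; apply/eqP; rewrite -subr_eq0; apply/eqP/inner_eq0.
have Lpy : L (orthoproj L x - y) by apply: subspaceB => //; exact: orthoproj_in.
rewrite -{1}(subrKA x) innerDl addrC xy// add0r -opprB -scaleN1r innerZl.
by rewrite sub_orthoproj// mulr0.
Qed.

Lemma orthoproj_linear L : closed_subspace L -> linear (orthoproj L).
Proof.
move=> sL a x y; apply: orthoproj_eq => //.
  by apply: subspaceZD => //; exact: orthoproj_in.
rewrite opprD addrACA -scalerBr.
by apply: (subspaceZD (ortho_compl_closed_subspace L)); exact: sub_orthoproj.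
Qed.

Lemma norm_orthoproj L x : closed_subspace L -> `|orthoproj L x| <= `|x|.
Proof.
move=> sL; rewrite -(@ler_pXn2r _ 2)// ?nnegrE//.
have /pythagoras : '[x - orthoproj L x, orthoproj L x] = 0.
  by apply: sub_orthoproj => //; exact: orthoproj_in.
by rewrite subrK => ->; rewrite lerDr exprn_ge0.
Qed.

Lemma ortho_complK L : closed_subspace L -> ortho_compl (ortho_compl L) = L.
Proof.
move=> sL; apply/seteqP; split=> [x MMx|x Lx y My]; last first.
  exact/inner_sym0/My.
have -> : x = orthoproj L x; last exact: orthoproj_in.
apply/eqP; rewrite -subr_eq0; apply/eqP/inner_eq0.
have Mx := @sub_orthoproj L x sL.
by rewrite {1}innerBl MMx// (inner_sym0 (Mx _ _)) ?subrr//; exact: orthoproj_in.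
Qed.

(** * Schmidt decompositions from orthogonal families *)

(** [T] has the same value at [h] and at the sum [y] of the Fourier series of [h]
  along the normalized [w j], and being continuous it can be applied to that
  series term by term. Only those [j] such that [T (w j)] is nonzero are kept,
  as singular values have to be positive. *)
Lemma schmidt_of_orthogonal_family L (T : {linear H -> H})
    (J : choiceType) (w : J -> H) :
  closed_subspace L -> (forall x, L (T x)) -> (forall x, `|T x| <= `|x|) ->
  (forall j, L (w j)) ->
  (forall j k, j <> k -> '[w j, w k] = 0) ->
  (forall j k, j <> k -> '[T (w j), T (w k)] = 0) ->
  (forall x, L x -> (forall j, T (w j) != 0 -> '[x, w j] = 0) -> T x = 0) ->
  schmidt_decomposable_on L T.
Proof.
move=> sL LT Tle Lw w0 Tw0 Tker.
have nreal x : ((complex.Re `|x|)%:C)%C = `|x| :> R[i].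
  by rewrite RRe_real// ger0_real.
pose I := {j : J | T (w j) != 0}.
pose n (x : H) := `|x|^-1 *: x.
have nn x : x != 0 -> '[n x, n x] = 1.
  move=> x0; rewrite -sqr_norm_inner normrZ normfV normr_id mulVf ?expr1n//.
  by rewrite normr_eq0.
have n0 x y : '[x, y] = 0 -> '[n x, n y] = 0.
  by move=> xy; rewrite innerZl innerZr xy !mulr0.
have wN0 (i : I) : w (val i) != 0.
  by apply: contraNneq (valP i) => ->; rewrite linear0.
have vneq (i k : I) : i <> k -> val i <> val k by move=> ik /val_inj.
have g_on : orthonormal_system (fun i : I => n (w (val i))).
  by split=> [i|i k /vneq ik]; [exact: nn|exact/n0/w0].
exists I, (fun i => complex.Re `|T (w (val i))| / complex.Re `|w (val i)|),
  (fun i => n (T (w (val i)))), (fun i => n (w (val i))); split.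
- split; last by move=> i; exact: subspaceZ.
  by split=> [i|i k /vneq ik]; [exact/nn/(valP i)|exact/n0/Tw0].
- by split=> // i; exact: subspaceZ.
- by move=> i; rewrite divr_gt0// -ltcR nreal normr_gt0//; exact: (valP i).
move=> h Lh.
have Lg (i : I) : L (n (w (val i))) by exact: subspaceZ.
have [y [Sy Ly hy]] := fourier_limit g_on h sL Lg.
have -> : T h = T y.
  apply/eqP; rewrite -subr_eq0 -raddfB; apply/eqP/Tker; first exact: subspaceB.
  move=> j Twj; have := hy (exist _ j Twj : I); rewrite innerZr => /eqP.
  rewrite mulf_eq0 conjC_eq0 invr_eq0 normr_eq0 => /orP[wj|/eqP//].
  by rewrite (eqP wj) (inner_sym0 (inner0l _)).
have TS A : partial_sum (fun i : I =>
    ((complex.Re `|T (w (val i))| / complex.Re `|w (val i)|)%:C)%C *: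
    rank_one (n (T (w (val i)))) (n (w (val i))) h) A =
    T (partial_sum (fun i : I => '[h, n (w (val i))] *: n (w (val i))) A).
  rewrite /partial_sum raddf_sum/=; apply: eq_bigr => -[i iA] _ /=.
  rewrite /rank_one /n rmorphM/= fmorphV/= !nreal !linearZ/= !scalerA.
  congr (_ *: _).
  by rewrite mulrA divfK// normr_eq0; exact: (valP i).
suff Ty : T (partial_sum (fun i : I => '[h, n (w (val i))] *: n (w (val i))) A)
    @[A --> totally] --> T y.
  by apply: cvg_trans Ty; apply: near_eq_cvg; apply: nearW => A; rewrite -TS.
apply/pseudometric_normed_Zmodule.cvgrPdist_le => r r0.
near=> A; rewrite -raddfB; apply: (le_trans (Tle _)).
near: A; exact: (pseudometric_normed_Zmodule.cvgr_dist_le _ _ Sy).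
Unshelve. all: by end_near.
Qed.

Lemma compression_schmidt L (U : {linear H -> H})
    (J : choiceType) (w : J -> H) (T := orthoproj L \o U) :
  closed_subspace L -> (forall x, `|U x| <= `|x|) ->
  (forall j, L (w j)) ->
  (forall j k, j <> k -> '[w j, w k] = 0) ->
  (forall j k, j <> k -> '[T (w j), T (w k)] = 0) ->
  (forall x, L x -> (forall j, T (w j) != 0 -> '[x, w j] = 0) -> T x = 0) ->
  schmidt_decomposable_on L T.
Proof.
move=> sL Ule Lw w0 Tw0 Tker.
have T_lin : linear T.
  by move=> a x y; rewrite /T/= linearP orthoproj_linear.
pose T' : {linear H -> H} := HB.pack T (GRing.isLinear.Build _ _ _ _ T T_lin).
apply: (@schmidt_of_orthogonal_family L T' J w) => //= x.
- exact: orthoproj_in.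
- exact: le_trans (norm_orthoproj _ sL) (Ule x).
Qed.

(** * Consequences of a singular value decomposition *)

Section SingularValueDecomposition.
Variables (L : set H) (T : H -> H) (J : choiceType) (s : J -> R) (f g : J -> H).
Hypothesis svd : singular_value_decomposition L T s f g.
Local Notation sc j := ((s j)%:C)%C.

Lemma svd_cvg h : L h ->
  partial_sum (fun j => (sc j * '[h, g j]) *: f j) A @[A --> totally] --> T h.
Proof.
move=> Lh; have [_ _ _ /(_ h Lh)] := svd.
by under [X in X @ _]eq_fun do under [X in partial_sum X _]eq_fun do
  rewrite /rank_one scalerA.
Qed.

Lemma svd_inner h k : L h -> '[T h, f k] = sc k * '[h, g k].
Proof.
move=> Lh; apply: (inner_cvg (svd_cvg Lh)); exists [fset k]%fset => // A kA.
have [[f_on _] _ _ _] := svd.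
by rewrite /= inner_partial_sum// (fsubsetP kA)// inE.
Qed.

Lemma svd_range h y : L h -> (forall j, '[f j, y] = 0) -> '[T h, y] = 0.
Proof.
move=> Lh fy; apply: (inner_cvg (svd_cvg Lh)); apply: nearW => A.
by rewrite /partial_sum inner_suml big1// => j _; rewrite innerZl fy mulr0.
Qed.

(** The difference of the two sides is orthogonal to every [f j], hence to the
  range of [T] as well as to [f k], hence to itself. *)
Lemma svd_apply k : T (g k) = sc k *: f k.
Proof.
have [[[f1 f0] _] [[g1 g0] Lg] _ _] := svd.
apply/eqP; rewrite -subr_eq0; apply/eqP.
have fD j : '[f j, T (g k) - sc k *: f k] = 0.
  apply: inner_sym0; rewrite innerBl svd_inner// innerZl.
  have [->|/eqP jk] := eqVneq j k; first by rewrite f1 g1 subrr.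
  by rewrite g0 ?f0 ?mulr0 ?subrr//; exact: nesym.
by apply: inner_eq0; rewrite {1}innerBl innerZl fD mulr0 subr0 svd_range.
Qed.

End SingularValueDecomposition.

(** * Compressions of a unitary operator *)

Section Unitary.
Variables (U : {linear H -> H}) (L : set H) (sL : closed_subspace L).
Hypothesis U_unitary : unitary U.
Local Notation M := (ortho_compl L).

Lemma unitary_isometry x y : '[U x, U y] = '[x, y].
Proof. by have [V [UV UK _]] := U_unitary; rewrite UV UK. Qed.

Lemma norm_unitary x : `|U x| = `|x|.
Proof.
by apply/eqP; rewrite -(@eqrXn2 _ 2)// !sqr_norm_inner unitary_isometry.
Qed.

(** The family that diagonalizes the compression to [M] consists of the vectors
  [C j = V (f j) - s j g j], mapped to multiples of [D j = U (g j) - s j f j],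
  and of a complete orthonormal system of [N]. *)
Lemma Sd_ortho_compl : Sd U L -> Sd U M.
Proof.
move=> [_ [J [s [f [g svd]]]]].
have sM := ortho_compl_closed_subspace L.
split=> //.
have [V [UV UK VK]] := U_unitary.
have VU x y : '[V x, y] = '[x, U y] by rewrite innerC -UV -innerC.
have [[[f1 f0] Lf] [[g1 g0] Lg] s_gt0 _] := svd.
pose c j : R[i] := ((s j)%:C)%C.
have cJ j : Num.conj (c j) = c j.
  by apply/CrealP; rewrite ger0_real// ler0c ltW.
have c0 j : c j != 0 by rewrite gt_eqF// (ltcR 0).
have orthM x y : L x -> M y -> '[x, y] = 0 by move=> Lx My; exact/inner_sym0/My.
pose D j := U (g j) - c j *: f j.
have MD j : M (D j).
  by rewrite /D -(svd_apply svd); exact: sub_orthoproj.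
have Ugf j k : '[U (g j), f k] = c j * '[f j, f k].
  by apply/eqP; rewrite -subr_eq0 -innerZl -innerBl; apply/eqP/MD.
pose C j := V (f j) - c j *: g j.
have MC j : M (C j).
  move=> h Lh; rewrite innerBl innerZl VU innerC.
  rewrite -[U h](subrK (orthoproj L (U h))) innerDl sub_orthoproj// add0r.
  have /= -> := svd_inner svd j Lh.
  by rewrite rmorphM/= cJ -innerC subrr.
have UC j : orthoproj M (U (C j)) = - c j *: D j.
  apply: orthoproj_eq => //; first exact: (subspaceZ sM).
  (* The component of U (C j) in L, orthogonal to M. *)
  have -> : U (C j) - - c j *: D j = (1 - c j * c j) *: f j.
    rewrite /C raddfB/= VK linearZ/= /D scaleNr opprK scalerBr scalerBl.
    by rewrite scale1r scalerA addrA subrK.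
  by move=> x Mx; rewrite innerZl orthM// mulr0.
(* Written as an orthogonal complement, the space of the x in M such that U x
   is in M is closed without further proof. *)
pose N := ortho_compl (L `|` V @` L).
have NM x : N x -> M x /\ M (U x).
  move=> Nx; split=> y Ly; first by apply: Nx; left.
  by rewrite UV; apply: Nx; right; exists y.
have [K [e [[e1 e0] Ne Ntotal]]] :=
  orthonormal_basis_exists (ortho_compl_closed_subspace (L `|` V @` L)).
have eNM k := NM _ (Ne k).
(* With y the projection of U x to L, orthogonality to V (f j) puts V y in M;
   then z = x - V y is in N and orthogonal to the system e, hence zero. *)
have Tker x : M x -> (forall j, '[x, V (f j)] = 0) -> (forall k, '[x, e k] = 0) ->
    orthoproj M (U x) = 0.
  move=> Mx xVf xe; pose y := orthoproj L (U x).
  have Ly : L y by exact: orthoproj_in.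
  have MVy : M (V y).
    move=> h Lh; rewrite VU; apply: inner_sym0.
    rewrite -[U h](subrK (orthoproj L (U h))) innerDl sub_orthoproj// add0r.
    apply: (svd_range svd) => // j; apply: inner_sym0.
    have := sub_orthoproj (U x) sL (Lf j).
    by rewrite innerBl UV xVf sub0r => /eqP; rewrite oppr_eq0 => /eqP.
  pose z := x - V y.
  have Uz : U z = U x - y by rewrite raddfB/= VK.
  have MUz : M (U z) by rewrite Uz; exact: sub_orthoproj.
  have Mz : M z by exact: (subspaceB sM).
  have Nz : N z.
    by move=> _ [/Mz//|[h Lh <-]]; rewrite -UV; exact: MUz.
  have -> : orthoproj M (U x) = U z.
    apply: orthoproj_eq => // t Mt.
    by rewrite Uz subKr; exact: orthM.
  suff -> : z = 0 by rewrite raddf0.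
  apply: Ntotal => // k; rewrite innerBl xe VU orthM ?subr0//.
  exact: (eNM k).2.
have Ue k : orthoproj M (U (e k)) = U (e k).
  apply: orthoproj_eq => //; first exact: (eNM k).2.
  by rewrite subrr => x _; exact: inner0l.
pose w i := match i with inl j => C j | inr k => e k end.
apply: (@compression_schmidt _ _ (J + K)%type w) => //.
- by move=> x; rewrite norm_unitary.
- by case=> [j|k] //=; exact: (eNM k).1.
- have CM j x : M x -> '[C j, x] = '[f j, U x].
    by move=> Mx; rewrite innerBl innerZl (orthM (g j))// mulr0 subr0 VU.
  have Ce j k : '[C j, e k] = 0.
    by rewrite CM ?orthM//; [exact: (eNM k).2|exact: (eNM k).1].
  have CC j k : j <> k -> '[C j, C k] = 0.
    move=> jk; rewrite CM// /C raddfB/= VK linearZ/= innerBr innerZr f0// sub0r.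
    rewrite (inner_sym0 (_ : '[U (g k), f j] = 0)) ?mulr0 ?oppr0//.
    by rewrite Ugf f0 ?mulr0//; exact: nesym.
  move=> [j|k] [j'|k'] /= ij.
  + by apply: CC => jj'; apply: ij; rewrite jj'.
  + exact: Ce.
  + exact/inner_sym0/Ce.
  + by apply: e0 => kk'; apply: ij; rewrite kk'.
- have DM j x : M x -> '[D j, x] = '[U (g j), x].
    by move=> Mx; rewrite innerBl innerZl (orthM (f j))// mulr0 subr0.
  have De j k : '[D j, U (e k)] = 0.
    rewrite DM ?unitary_isometry ?orthM//; first exact: (eNM k).1.
    exact: (eNM k).2.
  have DD j k : j <> k -> '[D j, D k] = 0.
    move=> jk; rewrite DM//.
    by rewrite innerBr unitary_isometry g0// innerZr Ugf f0// !mulr0 subrr.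
  move=> [j|k] [j'|k'] /= ij; rewrite ?UC ?Ue ?innerZl ?innerZr.
  + by rewrite DD ?mulr0// => jj'; apply: ij; rewrite jj'.
  + by rewrite De mulr0.
  + by rewrite (inner_sym0 (De _ _)) mulr0.
  + by rewrite unitary_isometry e0// => kk'; apply: ij; rewrite kk'.
- move=> x Mx xw; apply: Tker => // [j|k].
    have xg : '[x, g j] = 0 by exact/Mx.
    (* If D j = 0, then f j is proportional to U (g j), and x is orthogonal to
       V (f j) because it is orthogonal to g j. *)
    have [Dj|Dj] := eqVneq (D j) 0; last first.
      have := xw (inl j); rewrite /= UC innerBr innerZr xg mulr0 subr0.
      by apply; rewrite scaler_eq0 oppr_eq0 negb_or c0.
    have : '[U x, U (g j)] = 0 by rewrite unitary_isometry.
    have -> : U (g j) = c j *: f j by apply/eqP; rewrite -subr_eq0; exact/eqP.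
    rewrite innerZr cJ UV => /eqP.
    by rewrite mulf_eq0 (negbTE (c0 j)) => /eqP.
  apply: (xw (inr k)).
  by rewrite /= Ue -normr_eq0 norm_unitary normr_eq0 (unit_neq0 (e1 k)).
Qed.

Lemma Sd_invariant : invariant_subspace U L -> Sd U L.
Proof.
move=> UL; split=> //.
have [K [e [[e1 e0] Le Ltotal]]] := orthonormal_basis_exists sL.
have PU x : L x -> orthoproj L (U x) = U x.
  move=> Lx; apply: orthoproj_eq => //; first by apply: UL; exists x.
  by rewrite subrr => y _; exact: inner0l.
apply: (@compression_schmidt _ _ K e) => //.
- by move=> x; rewrite norm_unitary.
- by move=> j k jk; rewrite /= !PU// unitary_isometry e0.
- move=> x Lx xe; rewrite /= PU//; suff -> : x = 0 by rewrite raddf0.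
  apply: Ltotal => // j; apply: xe; rewrite /= PU//.
  by rewrite -normr_eq0 norm_unitary normr_eq0 (unit_neq0 (e1 j)).
Qed.

End Unitary.

End HilbertSpace.

Theorem proposition3p1 (R : realType) (H : hilbertType R)
    (U : {linear H -> H}) (L : set H) :
  unitary U -> closed_subspace L ->
  [/\ (Sd U L -> Sd U (ortho_compl L)),
      (invariant_subspace U L -> Sd U L) &
      (forall V : H -> H, is_adjoint U V -> invariant_subspace V L -> Sd U L)].
Proof.
move=> U_unitary sL; split.
- exact: Sd_ortho_compl.
- exact: Sd_invariant.
- move=> V UV VL; rewrite -(ortho_complK sL).
  have sM := ortho_compl_closed_subspace L.
  apply: Sd_ortho_compl => //; apply: Sd_invariant => //.
  move=> _ [x Mx <-] h Lh; rewrite UV; apply: Mx.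
  by apply: VL; exists h.
Qed.
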